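(* Let $Q$ be an absolutely continuous stochastic algorithm with Hamiltonian $H$, and suppose that for all $k\in[n]$, $h\in\mathcal{H}$, $y,y'\in\mathcal{X}$ and $\mathbf{x}\in\mathcal{X}^n$ we have $D^k_{y,y'}H(h,\mathbf{x})\le c$ and $h(y)\in[0,b]$. Then: (i) For any $\lambda>0$, $$\ln \mathbb{E}_{\mathbf{X}\sim\mu^n}\mathbb{E}_{h\sim Q_{\mathbf{X}}}\left[e^{\lambda\Delta(h,\mathbf{X})}\right]\le\sup_{h\in\mathcal{H}}\psi_{\lambda\Delta}(h)\le \frac{n}{8}\left(\frac{\lambda b}{n}+2c\right)^2.$$ (ii) For $\delta>0$, with probability at least $1-\delta$ as $\mathbf{X}\sim\mu^n$ and $h\sim Q_{\mathbf{X}}$, $$\Delta(h,\mathbf{X})\le b\left(c+\sqrt{\frac{\ln(1/\delta)}{2n}}\right).$$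
   Context: $\mathcal{X}$ is a measurable space with probability measure $\mu$, $\mathbf{X}=(X_1,\dots,X_n)\sim\mu^n$, $X\sim\mu$, and primes denote independent copies. $\mathcal{H}$ is a measurable space of measurable functions $h:\mathcal{X}\to[0,\infty)$ with nonnegative a-priori measure $\pi$. A stochastic algorithm $Q:\mathbf{x}\mapsto Q_{\mathbf{x}}$ (probability measures on $\mathcal{H}$) is absolutely continuous if each $Q_{\mathbf{x}}$ and $\pi$ are mutually absolutely continuous. A measurable $H:\mathcal{H}\times\mathcal{X}^n\to\mathbb{R}$ is a Hamiltonian for $Q$ if $dQ_{\mathbf{x}}(h)=e^{H(h,\mathbf{x})}d\pi(h)/Z(\mathbf{x})$ with $Z(\mathbf{x})=\int_{\mathcal{H}}e^{H(h,\mathbf{x})}d\pi(h)$; the canonical Hamiltonian is $H_Q=H-\ln Z=\ln(dQ_{\mathbf{x}}/d\pi)$. Generalization gap: $\Delta(h,\mathbf{x})=\mathbb{E}[h(X)]-\frac1n\sum_{i=1}^n h(x_i)$. For $F:\mathcal{H}\times\mathcal{X}^n\to\mathbb{R}$, $\psi_F(h)=\ln\mathbb{E}\left[\exp\left(F(h,\mathbf{X})+H_Q(h,\mathbf{X})-\mathbb{E}[H_Q(h,\mathbf{X}')]\right)\right]$. $S^k_y\mathbf{x}$ replaces the $k$-th coordinate of $\mathbf{x}$ by $y$; $D^k_{y,y'}G(h,\mathbf{x})=G(h,S^k_y\mathbf{x})-G(h,S^k_{y'}\mathbf{x})$. Probability ''as $\mathbf{X}\sim\mu^n$ and $h\sim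 Q_{\mathbf{X}}$'' is w.r.t. the joint law. All functions are assumed to have finite exponential moments of all orders. *)

(* Defs.v *)
From HB Require Import structures.
From mathcomp Require Import all_boot all_order all_algebra.
From mathcomp Require Import all_classical all_reals all_analysis.
Set Implicit Arguments. Unset Strict Implicit. Unset Printing Implicit Defensive.
Import Order.TTheory GRing.Theory Num.Theory.
Local Open Scope classical_set_scope.
Local Open Scope ring_scope.

(* Integration w.r.t. the n-fold product measure mu^n on n.-tuple T,
   written as iterated integration over the independent coordinates:
   E_{X ~ mu^n}[f X] = \int mu(dx_1) ... \int mu(dx_n) f (x_1,...,x_n). *)
Fixpoint tuple_int d (T : measurableType d) (R : realType)
    (mu : {measure set T -> \bar R}) (n : nat)
    : (n.-tuple T -> \bar R) -> \bar R :=
  match n return (n.-tuple T -> \bar R) -> \bar R with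
  | 0 => fun f => f [tuple]
  | m.+1 => fun f => (\int[mu]_x tuple_int mu (fun t : m.-tuple T => f (cons_tuple x t)))%E
  end.

Definition replace_at (T : Type) (n : nat) (x : n.-tuple T) (k : 'I_n) (y : T)
  : n.-tuple T := [tuple (if i == k then y else tnth x i) | i < n].

(* Partition function Z(x) = \int e^{H(h,x)} dpi(h)  (real; finite by hypothesis) *)
Definition partZ d' (Hs : measurableType d') (R : realType)
    (pi : {measure set Hs -> \bar R}) (A : Type) (H : Hs -> A -> R) (x : A) : R :=
  fine (\int[pi]_h (expR (H h x))%:E)%E.

Definition canonH d' (Hs : measurableType d') (R : realType)
    (pi : {measure set Hs -> \bar R}) (A : Type) (H : Hs -> A -> R) (h : Hs) (x : A) : R :=
  H h x - ln (partZ pi H x).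

Definition gen_gap d (X : measurableType d) (R : realType)
    (mu : {measure set X -> \bar R}) (Hs : Type) (ev : Hs -> X -> R)
    (n : nat) (h : Hs) (x : n.-tuple X) : R :=
  fine (\int[mu]_y (ev h y)%:E)%E - (n%:R)^-1 * \sum_(i < n) ev h (tnth x i).

Definition psiF d (X : measurableType d) (R : realType)
    (mu : {measure set X -> \bar R}) (n : nat)
    d' (Hs : measurableType d') (pi : {measure set Hs -> \bar R})
    (H : Hs -> n.-tuple X -> R) (F : Hs -> n.-tuple X -> R) (h : Hs) : R :=
  let HQ := canonH pi H h in
  let EHQ := fine (tuple_int mu (fun x' => (HQ x')%:E)) in
  ln (fine (tuple_int mu (fun x => (expR (F h x + HQ x - EHQ))%:E))).

(* Main.v *)
(* The canonical Hamiltonian HQ = H - ln Z has differences bounded by 2c, since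
   both H and ln Z have differences bounded by c. Exchanging the integrals,
     E_X E_{h ~ Q_X} e^(lam gap) = int E_X e^(lam gap + HQ) dpi
       = int e^(psi h) e^(E HQ(h, X)) dpi <= sup_h e^(psi h) int E_X e^HQ dpi
   by Jensen's inequality, and the last integral is 1. As the gap is centered
   and has differences bounded by b / n, the function lam gap + HQ has mean
   E HQ and differences bounded by lam b / n + 2c, so McDiarmid's inequality
   for the moment generating function (Hoeffding's lemma applied coordinate by
   coordinate) bounds psi. Part (ii) is Markov's inequality with the optimal
   lam. *)

Require Import Defs.
From HB Require Import structures.
From mathcomp Require Import all_boot all_order all_algebra.
From mathcomp Require Import all_classical all_reals all_analysis.
From mathcomp Require Import measurable_realfun ring lra.
Set Implicit Arguments. Unset Strict Implicit. Unset Printing Implicit Defensive.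
Import Order.TTheory GRing.Theory Num.Theory.
Import numFieldNormedType.Exports.
Local Open Scope classical_set_scope.
Local Open Scope ring_scope.

(** * Exponential moments of a Bernoulli variable *)

Lemma derive_ge0_le_0 (R : realType) (f f' : R -> R) (t : R) :
  (forall x : R, 0 <= x -> is_derive x 1 f (f' x)) ->
  (forall x : R, 0 <= x -> 0 <= f' x) -> 0 <= t -> f 0 <= f t.
Proof.
move=> df f'0 t0.
have [||x xt] := @MVT_segment R f f' 0 t t0.
- by move=> x; rewrite in_itv/= => /andP[/ltW x0 _]; exact: df.
- apply: derivable_within_continuous => x; rewrite in_itv/= => /andP[x0 _].
  by apply: ex_derive; exact: df.
- move=> ft; rewrite -subr_ge0 ft subr0 mulr_ge0// f'0//.
  by move: xt; rewrite in_itv/= => /andP[].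
Qed.

Section hoeffding_scalar.
Variables (R : realType) (p : R).
Hypothesis p01 : 0 <= p <= 1.

Let D (t : R) : R := 1 - p + p * expR t.

Let D_gt0 t : 0 < D t.
Proof.
rewrite /D; have := expR_gt0 t; case/andP: p01 => p0 p1 et.
(* At [p = 1] the constant part vanishes and the exponential alone gives positivity. *)
have [->|pn1] := eqVneq p 1; first by rewrite subrr add0r mul1r.
apply: ltr_pwDl; first by rewrite subr_gt0 lt_neqAle pn1.
by rewrite mulr_ge0// ltW.
Qed.

Let is_derive_D (t : R) : is_derive t 1 D (p * expR t).
Proof.
have := is_deriveD (is_derive_cst (1 - p) t (1 : R)) (is_deriveZ p (is_derive_expR t)).
by rewrite add0r.
Qed.

(** The left side, call it [s], is the derivative of [ln D]. Since [s' = s (1 - s)], the derivative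
    of [p + t / 4 - s] is the square [(1 / 2 - s) ^ 2], and both sides agree at 0. *)
Let sigmoid_le (t : R) : 0 <= t -> p * expR t / D t <= p + t / 4.
Proof.
move=> t0; pose f (x : R) := p + x / 4 - p * expR x / D x.
suff : f 0 <= f t by rewrite /f expR0 /D expR0 mulr1 subrK; lra.
apply: (@derive_ge0_le_0 R f (fun x : R => (1 / 2 - p * expR x / D x) ^+ 2) t _ _ t0);
  last by move=> x _; exact: sqr_ge0.
move=> x _; have Dx := D_gt0 x; have Dx0 : D x != 0 by rewrite gt_eqF.
have /= dq := is_deriveM (is_deriveZ p (is_derive_expR x)) (is_deriveV Dx0 (is_derive_D x)).
have dp := is_deriveD (is_derive_cst p x (1 : R)) (is_deriveZ 4^-1 (is_derive_id x (1 : R))).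
have -> : f = (cst p + (4^-1 \*: id) - (p \*: expR) * (fun y => (D y)^-1))%R.
  by apply/funext => y; rewrite /f /= mulrC.
apply: (@is_derive_eq _ _ _ _ _ _ _ _ (is_deriveB dp dq)).
rewrite /GRing.scale/= /D in Dx0 *; by field.
Qed.

(** This is [sigmoid_le] integrated from 0: [t ^ 2 / 8 + p t - ln (D t)] vanishes at 0, and its
    derivative is the gap in [sigmoid_le]. *)
Lemma bernoulli_mgf_le (t : R) : 0 <= t -> 1 - p + p * expR t <= expR (t ^+ 2 / 8 + p * t).
Proof.
move=> t0.
suff H : ln (D t) <= t ^+ 2 / 8 + p * t.
  by have := H; rewrite -ler_expR lnK// posrE D_gt0.
pose f (x : R) := x ^+ 2 / 8 + p * x - ln (D x).
have f0 : f 0 = 0 by rewrite /f /D expR0 mulr1 subrK ln1 expr0n/= mul0r mulr0 subr0 addr0.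
suff : f 0 <= f t by rewrite f0 /f subr_ge0.
apply: (@derive_ge0_le_0 R f (fun x : R => p + x / 4 - p * expR x / D x) t _ _ t0);
  last by move=> x x0; rewrite subr_ge0 sigmoid_le.
move=> x _.
have dl := @is_derive1_comp R (@ln R) D x _ _ (is_derive1_ln (D_gt0 x)) (is_derive_D x).
have dq := is_deriveZ 8^-1 (is_deriveM (is_derive_id x (1 : R)) (is_derive_id x (1 : R))).
have dp := is_deriveZ p (is_derive_id x (1 : R)).
have -> : f = (8^-1 \*: (id * id) + (p \*: id) - (@ln R \o D))%R.
  by apply/funext => y; rewrite /f expr2 mulrC.
apply: (@is_derive_eq _ _ _ _ _ _ _ _ (is_deriveB (is_deriveD dq dp) dl)).
have Dx0 : D x != 0 by rewrite gt_eqF// D_gt0.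
by rewrite /GRing.scale/= in Dx0 *; field.
Qed.
End hoeffding_scalar.

(** * Bounded functions under a probability measure *)

Section bounded_integrals.
Context d (T : measurableType d) (R : realType) (P : probability T R).

(** An empty space would have mass 0 instead of 1. The reference sample and reference hypothesis
    used later are obtained this way. *)
Lemma probability_inhabited : inhabited T.
Proof.
apply: contrapT => T0; have : [set: T] = set0.
  by apply/seteqP; split => // x _; apply: T0; exists.
move=> /(congr1 P); rewrite probability_setT measure0 => /eqP.
by rewrite onee_eq0.
Qed.

Lemma bounded_integrable (f : T -> R) (M : R) : measurable_fun setT f ->
  (forall x, `|f x| <= M) -> P.-integrable setT (EFin \o f).
Proof.
move=> mf fM; apply: measurable_bounded_integrable => //.
  by rewrite [ltLHS](@probability_setT _ _ _ P) ltry.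
exists M; split; first exact: num_real.
by move=> N MN x _ /=; rewrite (le_trans (fM x))// ltW.
Qed.

Lemma integral_prob_cst (r : R) : (\int[P]_x r%:E = r%:E)%E.
Proof. by rewrite integral_cst// [X in (_ * X)%E](@probability_setT _ _ _ P) mule1. Qed.

End bounded_integrals.

(** * Hoeffding's lemma *)

Lemma expR_chord_le (R : realType) (a y : R) : 0 < a -> 0 <= y <= a ->
  expR y <= 1 + y / a * (expR a - 1).
Proof.
move=> a0 /andP[y0 ya].
have t01 : 0 <= y / a <= 1.
  by rewrite divr_ge0 ?(ltW a0)//= ler_pdivrMr// mul1r.
case/andP: t01 => t0 t1.
(* [y] is the convex combination of [a] and 0 with weight [y / a] on [a]. *)
have := @convex_expR R (Itv01 t0 t1) a 0.
rewrite !convRE /=.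
by rewrite divfK ?gt_eqF// mulr0 addr0 expR0 /unstable.onem; lra.
Qed.

(** With [l] the infimum of [g], the values of [g] lie in [[l, l + a]], where the exponential is
    below its chord. The integral of the chord depends on [g] only through the mean [m]: up to the
    factor [expR (l - m)] it is the moment generating function at [a] of a Bernoulli variable with
    parameter [(m - l) / a]. *)
Lemma hoeffding_mgf d (T : measurableType d) (R : realType)
    (P : probability T R) (g : T -> R) (a : R) :
  measurable_fun setT g -> (forall x y, g x - g y <= a) ->
  (\int[P]_x (expR (g x - fine (\int[P]_z (g z)%:E)))%:E <=
   (expR (a ^+ 2 / 8))%:E)%E.
Proof.
move=> mg ga; have [x0] := probability_inhabited P.
have a0 : 0 <= a by rewrite (le_trans _ (ga x0 x0))// subrr.
pose l := inf (range g).
have hl : has_inf (range g).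
  split; first by exists (g x0), x0.
  by exists (g x0 - a) => _ [y _ <-]; have := ga x0 y; lra.
have lg x : l <= g x by apply: ge_inf; [exact: hl.2|exists x].
have gl x : g x <= l + a.
  rewrite -lerBlDr; apply: lb_le_inf; first exact: hl.1.
  by move=> _ [y _ <-]; have := ga x y; lra.
have ig : P.-integrable setT (EFin \o g).
  apply: (@bounded_integrable _ _ _ _ _ (`|l| + a)) => // x.
  have := lg x; have := gl x; have := ler_norm l; have := ler_norm (- l).
  by rewrite normrN ler_norml; lra.
set m := fine _.
have mE : (\int[P]_z (g z)%:E = m%:E)%E.
  by rewrite fineK//; exact: integrable_fin_num ig.
have lm : l <= m.
  rewrite -lee_fin -mE -(integral_prob_cst P l); apply: le_integral => //.
    exact: (@bounded_integrable _ _ _ _ (fun=> l) `|l|).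
  by move=> x _ /=; rewrite lee_fin.
have ml : m <= l + a.
  rewrite -lee_fin -mE -(integral_prob_cst P (l + a)); apply: le_integral => //.
    exact: (@bounded_integrable _ _ _ _ (fun=> l + a) `|l + a|).
  by move=> x _ /=; rewrite lee_fin.
have mexp r : measurable_fun setT (fun x => expR (g x - r)).
  by apply: measurableT_comp => //; exact: measurable_funB.
(* The Bernoulli parameter divides by [a]; for [a = 0] the function is constant and the integrand is
   1. *)
have [a_eq0|a_neq0] := eqVneq a 0.
  have gm x : g x = m by have := lg x; have := gl x; lra.
  under eq_integral do rewrite gm subrr expR0.
  by rewrite integral_prob_cst a_eq0 expr0n/= mul0r expR0.
have a_gt0 : 0 < a by rewrite lt_neqAle eq_sym a_neq0.
pose p := (m - l) / a.
have p01 : 0 <= p <= 1.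
  by rewrite divr_ge0 ?subr_ge0//= ler_pdivrMr// mul1r lerBlDl.
(* Slope of the chord of [y |-> expR (y - m)] over [[l, l + a]]. *)
pose k := (expR a - 1) / a * expR (l - m).
have chord x : expR (g x - m) <= expR (l - m) + k * (g x - l).
  have -> : g x - m = (g x - l) + (l - m) by ring.
  have := @expR_chord_le R a (g x - l) a_gt0.
  rewrite subr_ge0 lg/= lerBlDl gl => /(_ isT) H.
  rewrite expRD; apply: (le_trans (ler_wpM2r (expR_ge0 (l - m)) H)).
  by rewrite /k le_eqVlt; apply/orP; left; apply/eqP; field.
apply: (@le_trans _ _ (\int[P]_x ((expR (l - m) - k * l)%:E + k%:E * (g x)%:E))%E).
  apply: ge0_le_integral => //.
  - by apply/measurable_EFinP.
  - apply: emeasurable_funD => //; apply: emeasurable_funM => //.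
    exact/measurable_EFinP.
  - move=> x _; rewrite -EFinM -EFinD lee_fin; have := chord x; lra.
rewrite integralD//; last 2 first.
- exact: (@bounded_integrable _ _ _ _ (fun=> (expR (l - m) - k * l)) `|(expR (l - m) - k * l)|).
- exact: integrableZl.
rewrite integral_prob_cst integralZl// mE -EFinM -EFinD lee_fin.
have := bernoulli_mgf_le p01 a0.
(* As [p * a = m - l], the linear term of the Bernoulli bound cancels against the factor
   [expR (l - m)]. *)
have -> : a ^+ 2 / 8 + p * a = a ^+ 2 / 8 - (l - m) by rewrite /p; field.
rewrite [in X in X -> _]expRB ler_pdivlMr ?expR_gt0// => H; apply: le_trans H.
by rewrite /k /p le_eqVlt; apply/orP; left; apply/eqP; field.
Qed.

(** * The product measure on tuples *)

Section tuple_probability.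
Context d (X : measurableType d) (R : realType) (mu : probability X R).

Definition cons_pair n (p : X * n.-tuple X) : n.+1.-tuple X :=
  cons_tuple p.1 p.2.

Lemma measurable_cons_pair n : measurable_fun setT (@cons_pair n).
Proof. exact: measurable_cons. Qed.

HB.instance Definition _ n :=
  isMeasurableFun.Build _ _ _ _ (@cons_pair n) (@measurable_cons_pair n).

(** The law mu^n as a genuine measure. The recursion mirrors that of [tuple_int], so that Fubini
    peels off one coordinate at a time and the theory of the integral becomes available for iterated
    integrals. *)
Fixpoint tuple_probability n : probability (n.-tuple X) R :=
  match n with
  | 0 => \d_([tuple] : 0.-tuple X)
  | m.+1 => distribution (mu \x tuple_probability m)%E (@cons_pair m)
  end.

Lemma tuple_intE n (f : n.-tuple X -> \bar R) : measurable_fun setT f ->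
  (forall x, 0 <= f x)%E -> (tuple_int mu f = \int[tuple_probability n]_x f x)%E.
Proof.
elim: n f => [|n IH] f mf f0 /=.
  by rewrite integral_dirac// diracT mul1e.
rewrite ge0_integral_pushforward// preimage_setT fubini_tonelli1//; last 2 first.
- exact: (measurableT_comp mf (@measurable_cons_pair n)).
- by move=> p; exact: f0.
apply: eq_integral => x _; rewrite IH//.
apply: measurableT_comp => //; exact: measurable_cons.
Qed.

(** Signed counterpart of [tuple_intE], needed for means. Boundedness gives the integrability that
    Fubini asks for, and every slice inherits the same [M]. *)
Lemma tuple_int_boundedE n (f : n.-tuple X -> R) (M : R) :
  measurable_fun setT f -> (forall x, `|f x| <= M) ->
  (tuple_int mu (EFin \o f) = \int[tuple_probability n]_x (f x)%:E)%E.
Proof.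
elim: n f => [|n IH] f mf fM /=.
  by rewrite integral_dirac// ?diracT ?mul1e//; exact/measurable_EFinP.
have fi : (mu \x tuple_probability n)%E.-integrable setT (EFin \o (f \o @cons_pair n)).
  apply: (@bounded_integrable _ _ _ (mu \x tuple_probability n)%E _ M); last by move=> p; exact: fM.
  exact: (measurableT_comp mf (@measurable_cons_pair n)).
have mEf : measurable_fun setT (EFin \o f) by exact/measurable_EFinP.
rewrite [RHS](integral_pushforward (@measurable_cons_pair n) mEf)//.
rewrite preimage_setT -(integral12_prod_meas1 fi).
apply: eq_integral => x _.
apply: (etrans (IH (fun t => f (cons_tuple x t)) _ _)) => //.
by apply: measurableT_comp => //; exact: measurable_cons.
Qed.

End tuple_probability.

Section tuple_int_marginals.
Context d (X : measurableType d) (R : realType) (mu : probability X R).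

Lemma tuple_int_cst n (r : \bar R) : tuple_int mu (fun _ : n.-tuple X => r) = r.
Proof.
elim: n => //= n ->.
by rewrite integral_cst// [X in (_ * X)%E](@probability_setT _ _ _ mu) mule1.
Qed.

(** For the head coordinate the inner integrals are over a constant; for a later one the outer
    integral is, by induction. *)
Lemma tuple_int_tnth n (i : 'I_n) (f : X -> \bar R) :
  (tuple_int mu (fun x => f (tnth x i)) = \int[mu]_y f y)%E.
Proof.
elim: n i => [[]//|n IH] i /=.
case: (unliftP ord0 i) => [j|] ->.
  under eq_integral => x _.
    under eq_fun do rewrite tnthS.
    rewrite IH; over.
  by rewrite integral_cst// [X in (_ * X)%E](@probability_setT _ _ _ mu) mule1.
apply: eq_integral => x _; under eq_fun do rewrite tnth0.
by rewrite tuple_int_cst.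
Qed.

End tuple_int_marginals.

(** * Functions with bounded differences *)

Section bounded_differences.
Variables (T : Type) (R : realType).

(** One-sided as written, but exchanging [y] and [y'] bounds the absolute value as well. *)
Definition bounded_diff n (G : n.-tuple T -> R) (a : R) :=
  forall (k : 'I_n) (y y' : T) (x : n.-tuple T),
    G (replace_at x k y) - G (replace_at x k y') <= a.

Lemma replace_at_cons0 n (x y : T) (t : n.-tuple T) :
  replace_at (cons_tuple x t) ord0 y = cons_tuple y t.
Proof.
apply: eq_from_tnth => i; rewrite tnth_mktuple.
by case: (unliftP ord0 i) => [j|] ->; rewrite ?eqxx ?tnth0// eq_sym eq_liftF !tnthS.
Qed.

Lemma replace_at_consS n (x y : T) (t : n.-tuple T) (k : 'I_n) :
  replace_at (cons_tuple x t) (lift ord0 k) y = cons_tuple x (replace_at t k y).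
Proof.
apply: eq_from_tnth => i; rewrite tnth_mktuple.
case: (unliftP ord0 i) => [j|] ->; rewrite ?tnth0 ?tnthS.
  by rewrite tnth_mktuple (inj_eq lift_inj).
by rewrite eq_liftF.
Qed.

Lemma bounded_diff_head n (G : n.+1.-tuple T -> R) a : bounded_diff G a ->
  forall (x y : T) (t : n.-tuple T),
  G (cons_tuple x t) - G (cons_tuple y t) <= a.
Proof.
move=> Ga x y t.
by have := Ga ord0 x y (cons_tuple x t); rewrite !replace_at_cons0.
Qed.

Lemma bounded_diff_behead n (G : n.+1.-tuple T -> R) a x : bounded_diff G a ->
  bounded_diff (fun t : n.-tuple T => G (cons_tuple x t)) a.
Proof.
move=> Ga k y y' t.
by have := Ga (lift ord0 k) y y' (cons_tuple x t); rewrite !replace_at_consS.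
Qed.

(** Passing from [x] to [x'] one coordinate at a time costs at most [a] per coordinate. *)
Lemma bounded_diff_le n (G : n.-tuple T -> R) a : bounded_diff G a ->
  forall x x', G x - G x' <= n%:R * a.
Proof.
elim: n G => [|n IH] G Ga x x'; first by rewrite (tuple0 x) (tuple0 x') subrr mul0r.
have := IH _ (bounded_diff_behead (thead x) Ga) (behead_tuple x) (behead_tuple x').
have := bounded_diff_head Ga (thead x) (thead x') (behead_tuple x').
have E (z : n.+1.-tuple T) : cons_tuple (thead z) (behead_tuple z) = z.
  by apply/val_inj; rewrite /= [in RHS](tuple_eta z).
by rewrite !E -[n.+1%:R]natr1 mulrDl mul1r; lra.
Qed.

End bounded_differences.

(** Bounded differences thus force boundedness, which supplies integrability under mu^n for the
    functions to which McDiarmid's inequality is applied. *)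
Lemma bounded_diff_norm_le (T : Type) (R : realType) n (G : n.-tuple T -> R) a x0 :
  bounded_diff G a -> forall x, `|G x| <= `|G x0| + n%:R * a.
Proof.
move=> Ga x; have := bounded_diff_le Ga x x0; have := bounded_diff_le Ga x0 x.
have := ler_norm (G x0); have := ler_norm (- G x0).
by rewrite normrN ler_norml; lra.
Qed.

(** * McDiarmid's inequality for the moment generating function *)

Section mcdiarmid.
Context d (X : measurableType d) (R : realType) (mu : probability X R).

Lemma measurable_tuple_int d' (Y : measurableType d') n
    (f : Y * n.-tuple X -> \bar R) : measurable_fun setT f ->
  (forall p, 0 <= f p)%E ->
  measurable_fun setT (fun y => tuple_int mu (fun t => f (y, t))).
Proof.
move=> mf f0; rewrite [X in measurable_fun _ X](_ : _ =
    fubini_F (tuple_probability mu n) f); last first.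
  apply/funext => y; rewrite tuple_intE//.
  by apply: measurableT_comp => //; exact: measurable_pair1.
exact: measurable_fun_fubini_tonelli_F.
Qed.

(** Induction on [n], conditioning on the first coordinate [x]. Let [g x] be the conditional mean.
    The induction hypothesis bounds the fluctuation around [g x] by a factor independent of [x], and
    Hoeffding's lemma applied to [g] contributes one more factor [expR (a ^+ 2 / 8)]. *)
Lemma mcdiarmid_mgf n (G : n.-tuple X -> R) (a : R) :
  measurable_fun setT G -> bounded_diff G a ->
  (tuple_int mu (fun x =>
     (expR (G x - fine (tuple_int mu (EFin \o G))))%:E) <=
   (expR (n%:R * (a ^+ 2 / 8)))%:E)%E.
Proof.
have [y0] := probability_inhabited mu.
elim: n G => [|n IH] G mG Ga /=; first by rewrite subrr mul0r !expR0.
pose P := tuple_probability mu n.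
pose g x := fine (tuple_int mu (fun t : n.-tuple X => (G (cons_tuple x t))%:E)).
pose M := `|G (nseq_tuple n.+1 y0)| + n.+1%:R * a.
have GM : forall x, `|G x| <= M by exact: bounded_diff_norm_le.
have mGc : measurable_fun setT (G \o @cons_pair _ X n).
  exact: (measurableT_comp mG (@measurable_cons_pair _ X n)).
have mGx x : measurable_fun setT (fun t : n.-tuple X => G (cons_tuple x t)).
  by apply: (measurableT_comp mG); exact: measurable_cons.
have iGx x : P.-integrable setT (fun t : n.-tuple X => (G (cons_tuple x t))%:E).
  exact: (@bounded_integrable _ _ _ P _ M (mGx x) (fun t => GM _)).
have gE x : (\int[P]_t (G (cons_tuple x t))%:E = (g x)%:E)%E.
  rewrite /g (@tuple_int_boundedE _ _ _ mu _ _ M (mGx x))//.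
  by rewrite fineK//; exact: integrable_fin_num (iGx x).
have gE' x : (tuple_int mu (fun t : n.-tuple X => (G (cons_tuple x t))%:E) = (g x)%:E)%E.
  by rewrite -gE; exact: (@tuple_int_boundedE _ _ _ mu _ _ M (mGx x)).
have mg : measurable_fun setT g.
  apply/measurable_EFinP.
  rewrite [X in measurable_fun _ X](_ : _ =
      fubini_F P (EFin \o (G \o @cons_pair _ X n))); last first.
    by apply/funext => x /=; rewrite -gE.
  apply: (@measurable_fubini_F _ _ _ _ _ mu).
  exact: (@bounded_integrable _ _ _ (mu \x P)%E _ M mGc (fun p => GM _)).
(* Averaging over the tail preserves the bound on differences in the head. *)
have ga x y : g x - g y <= a.
  rewrite lerBlDr addrC -lee_fin EFinD -!gE -(integral_prob_cst P a) -integralD//; last first.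
    exact: (@bounded_integrable _ _ _ _ (fun=> a) `|a|).
  apply: le_integral => //.
    by apply: integrableD => //; exact: (@bounded_integrable _ _ _ _ (fun=> a) `|a|).
  by move=> t _; rewrite -EFinD lee_fin; have := bounded_diff_head Ga x y t; lra.
set m := fine _.
have mE : m = fine (\int[mu]_x (g x)%:E)%E.
  by rewrite /m; congr fine; apply: eq_integral => x _; exact: gE'.
have step x : (tuple_int mu (fun t : n.-tuple X => (expR (G (cons_tuple x t) - m))%:E) <=
    (expR (n%:R * (a ^+ 2 / 8)))%:E * (expR (g x - m))%:E)%E.
  have mexp r : measurable_fun setT (fun t : n.-tuple X => (expR (G (cons_tuple x t) - r))%:E).
    by apply/measurable_EFinP; apply: measurableT_comp => //; exact: measurable_funB.
  rewrite tuple_intE//.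
  under eq_integral => t _.
    (* The second summand does not depend on [t] and leaves the inner integral as a factor. *)
    have -> : G (cons_tuple x t) - m = (G (cons_tuple x t) - g x) + (g x - m) by ring.
    rewrite expRD EFinM; over.
  rewrite ge0_integralZr//.
  rewrite lee_wpmul2r ?lee_fin ?expR_ge0// -tuple_intE//.
  exact: IH (mGx x) (bounded_diff_behead x Ga).
apply: (@le_trans _ _ (\int[mu]_x ((expR (n%:R * (a ^+ 2 / 8)))%:E * (expR (g x - m))%:E))%E).
  apply: ge0_le_integral => //.
  - move=> x _; rewrite tuple_intE//.
      by apply: integral_ge0 => t _; rewrite lee_fin expR_ge0.
    by apply/measurable_EFinP; apply: measurableT_comp => //; exact: measurable_funB.
  - apply: (@measurable_tuple_int _ X n (fun p => (expR (G (cons_tuple p.1 p.2) - m))%:E)).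
      by apply/measurable_EFinP; apply: measurableT_comp => //; exact: measurable_funB mGc _.
    by move=> p; rewrite lee_fin expR_ge0.
  - apply: emeasurable_funM => //; apply/measurable_EFinP.
    by apply: measurableT_comp => //; exact: measurable_funB.
rewrite ge0_integralZl//; last first.
  by apply/measurable_EFinP; apply: measurableT_comp => //; exact: measurable_funB.
rewrite -[n.+1%:R]natr1 mulrDl mul1r expRD EFinM lee_wpmul2l ?lee_fin ?expR_ge0// mE.
exact: hoeffding_mgf.
Qed.

End mcdiarmid.

(** * Integration against a density *)

Section integral_density.
Context d (T : measurableType d) (R : realType).
Variables (mu nu : {measure set T -> \bar R}) (f : T -> R).
Hypotheses (mf : measurable_fun setT f) (f0 : forall x, 0 <= f x).
Hypothesis nuE : forall A, measurable A -> nu A = (\int[mu]_(x in A) (f x)%:E)%E.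

Import HBNNSimple.
Local Open Scope ereal_scope.

Let integral_density_nnsfun (h : {nnsfun T >-> R}) :
  \int[nu]_x (h x)%:E = \int[mu]_x ((h x)%:E * (f x)%:E).
Proof.
transitivity (\int[nu]_x (\sum_(y \in range h) (y * \1_(h @^-1` [set y]) x)%:E)).
  by apply: eq_integral => t _; rewrite fsumEFin// -fimfunE.
transitivity (\int[mu]_x (\sum_(y \in range h)
    (y * \1_(h @^-1` [set y]) x)%:E * (f x)%:E)); last first.
  apply: eq_integral => t _.
  by rewrite -ge0_mule_fsuml => [|y]; [rewrite fsumEFin// -fimfunE|exact: nnfun_muleindic_ge0].
have mfE : measurable_fun setT (EFin \o f) by exact/measurable_EFinP.
have indich r : measurable_fun setT (fun x => (r * \1_(h @^-1` [set r]) x)%:E).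
  by apply: (measurable_comp measurableT) => //; exact: measurable_funM.
rewrite ge0_integral_fsum//; last by move=> *; exact: nnfun_muleindic_ge0.
rewrite ge0_integral_fsum//; last 2 first.
- by move=> y; exact: emeasurable_funM.
- by move=> y x _; rewrite mule_ge0 ?lee_fin ?f0// -lee_fin nnfun_muleindic_ge0.
apply: eq_fsbigr => r; rewrite inE => -[x0 _ hx0].
have r0 : (0 <= r)%R by rewrite -hx0.
under eq_integral do rewrite EFinM.
rewrite integralZl_indic_nnsfun// integral_indic// setIT nuE//.
under [RHS]eq_integral do rewrite EFinM -muleA.
rewrite ge0_integralZl//; last 2 first.
- by apply: emeasurable_funM => //; exact/measurable_EFinP.
- by move=> x _; rewrite mule_ge0// lee_fin.
congr (_ * _); rewrite integral_mkcond; apply: eq_integral => x _.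
by rewrite muleC epatch_indic.
Qed.

(** The density is prescribed on sets only. Simple functions follow by linearity, and [g] by
    monotone convergence on both sides; [f] being nonnegative keeps the weighted approximations
    increasing. *)
Lemma integral_density (g : T -> \bar R) : measurable_fun setT g ->
  (forall x, 0 <= g x) -> \int[nu]_x g x = \int[mu]_x (g x * (f x)%:E).
Proof.
move=> mg g0; pose h := nnsfun_approx measurableT mg.
have gE x : g x = limn (fun n => (h n x)%:E).
  by apply/esym/cvg_lim => //; exact: cvg_nnsfun_approx.
have mfE : measurable_fun setT (EFin \o f) by exact/measurable_EFinP.
transitivity (limn (fun n => \int[nu]_x (h n x)%:E)).
  under eq_integral do rewrite gE.
  apply: monotone_convergence => //.
  - by move=> n; exact/measurable_EFinP.
  - by move=> n x _; rewrite lee_fin.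
  - by move=> x _ a b ab; rewrite lee_fin; exact/lefP/nd_nnsfun_approx.
under eq_fun do rewrite integral_density_nnsfun.
rewrite -monotone_convergence//.
- apply: eq_integral => x _; apply/cvg_lim => //.
  by apply: cvgeZr => //; exact: cvg_nnsfun_approx.
- by move=> n; apply: emeasurable_funM => //; exact/measurable_EFinP.
- by move=> n x _; rewrite mule_ge0 ?lee_fin.
- move=> x _ a b ab; rewrite lee_wpmul2r ?lee_fin//.
  exact/lefP/nd_nnsfun_approx.
Qed.

End integral_density.

(** * Jensen's inequality for the exponential, and bounds through the logarithm *)

Lemma jensen_expR d (T : measurableType d) (R : realType)
    (P : probability T R) (w : T -> R) (M : R) : measurable_fun setT w ->
  (forall x, `|w x| <= M) ->
  ((expR (fine (\int[P]_x (w x)%:E)))%:E <= \int[P]_x (expR (w x))%:E)%E.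
Proof.
move=> mw wM.
have iw : P.-integrable setT (EFin \o w) by exact: bounded_integrable wM.
set m := fine _; have mE : (\int[P]_z (w z)%:E = m%:E)%E.
  by rewrite fineK//; exact: integrable_fin_num iw.
have icst (r : R) : P.-integrable setT (fun=> r%:E).
  exact: (@bounded_integrable _ _ _ P (fun=> r) `|r|).
(* The integrand is the tangent of the exponential at the mean [m], evaluated at [w x]; it lies
   below [expR (w x)]. *)
have lin : (\int[P]_x ((expR m * (1 - m))%:E + (expR m)%:E * (w x)%:E) = (expR m)%:E)%E.
  rewrite integralD//; last exact: integrableZl.
  rewrite integral_prob_cst integralZl// mE -EFinM -EFinD.
  by congr EFin; ring.
rewrite -[leLHS]lin; apply: le_integral => //.
- by apply: integrableD => //; exact: integrableZl.
- apply: (@bounded_integrable _ _ _ P (fun x => expR (w x)) (expR M)).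
    exact: measurableT_comp.
  by move=> x; rewrite ger0_norm ?expR_ge0// ler_expR (le_trans _ (wM x))// ler_norm.
- move=> x _; rewrite -EFinM -EFinD lee_fin.
  have -> : expR (w x) = expR m * expR (w x - m) by rewrite -expRD; congr expR; ring.
  rewrite -mulrDr ler_pM2l ?expR_gt0//; have := expR_ge1Dx (w x - m); lra.
Qed.

Lemma le_expR_ln (R : realType) (x : R) : x <= expR (ln x).
Proof.
have [x0|x0] := ltP 0 x; first by rewrite lnK.
by rewrite (le_trans x0)// expR_ge0.
Qed.

(** For [x <= 0] the logarithm takes the default value 0, whence the condition on [K]. *)
Lemma ln_le_expR (R : realType) (x K : R) : 0 <= K -> x <= expR K -> ln x <= K.
Proof.
move=> K0 xK; have [x0|x0] := ltP 0 x; last by rewrite ln0.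
by rewrite -ler_expR lnK.
Qed.

(** * The canonical Hamiltonian and the exchange of integrals *)

Section gibbs.
Context (R : realType) d (X : measurableType d) (mu : probability X R) (n : nat).
Context d' (Hs : measurableType d') (pi : {measure set Hs -> \bar R}).
Variables (H : Hs -> n.-tuple X -> R) (Q : n.-tuple X -> probability Hs R).
Hypothesis mH :
  measurable_fun [set: Hs * n.-tuple X] (fun p : Hs * n.-tuple X => H p.1 p.2).
Hypothesis Z_fin : forall x : n.-tuple X, (0 < \int[pi]_h (expR (H h x))%:E < +oo)%E.
Hypothesis QE : forall (x : n.-tuple X) (A : set Hs), measurable A ->
  Q x A = (\int[pi]_(h in A) (expR (H h x) / partZ pi H x)%:E)%E.

Local Notation HQ := (canonH pi H).

Lemma partZE x : (\int[pi]_h (expR (H h x))%:E = (partZ pi H x)%:E)%E.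
Proof.
have /andP[Z0 Zoo] := Z_fin x.
by rewrite /partZ fineK// ge0_fin_numE// ltW.
Qed.

Lemma partZ_gt0 x : 0 < partZ pi H x.
Proof. by rewrite -lte_fin -partZE; have /andP[] := Z_fin x. Qed.

Lemma expR_canonH h x : expR (HQ h x) = expR (H h x) / partZ pi H x.
Proof. by rewrite /canonH expRB lnK// posrE partZ_gt0. Qed.

Lemma measurable_H_l x : measurable_fun setT (fun h => H h x).
Proof. exact: (measurableT_comp mH (measurable_pair2 x)). Qed.

Lemma measurable_canonH_l x : measurable_fun setT (fun h => HQ h x).
Proof. by apply: measurable_funB => //; exact: measurable_H_l. Qed.

Lemma integral_Q x (g : Hs -> \bar R) : measurable_fun setT g ->
  (forall h, 0 <= g h)%E ->
  (\int[Q x]_h g h = \int[pi]_h (g h * (expR (HQ h x))%:E))%E.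
Proof.
move=> mg g0.
apply: (@integral_density _ _ _ pi (Q x) (fun h => expR (HQ h x))) => //.
- by apply: measurableT_comp => //; exact: measurable_canonH_l.
- by move=> A mA; apply: (etrans (QE x mA)); apply: eq_integral => h _; rewrite expR_canonH.
Qed.

Variable x0 : n.-tuple X.

(* With the probability [Q x0] as base measure instead of [pi], Fubini-Tonelli
   applies without a detour through the sigma-finiteness of [pi]. *)
Lemma integral_Q_base x (g : Hs -> \bar R) : measurable_fun setT g ->
  (forall h, 0 <= g h)%E ->
  (\int[Q x]_h g h = \int[Q x0]_h (g h * (expR (HQ h x - HQ h x0))%:E))%E.
Proof.
move=> mg g0; rewrite (integral_Q x mg g0).
rewrite [RHS](@integral_Q x0 (fun h => g h * (expR (HQ h x - HQ h x0))%:E)%E); last 2 first.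
- apply: emeasurable_funM => //; apply/measurable_EFinP; apply: measurableT_comp => //.
  by apply: measurable_funB; exact: measurable_canonH_l.
- by move=> h; rewrite mule_ge0// lee_fin expR_ge0.
by apply: eq_integral => h _; rewrite -muleA -EFinM -expRD subrK.
Qed.

(** Z(x) is the integral of [expR (H h x - HQ h x0)] against the fixed probability [Q x0], so
    Tonelli gives its measurability in [x]. *)
Lemma measurable_partZ : measurable_fun setT (partZ pi H).
Proof.
apply/measurable_EFinP.
rewrite [X in measurable_fun _ X](_ : _ = fubini_G (Q x0)
    (fun p : Hs * n.-tuple X => (expR (H p.1 p.2 - HQ p.1 x0))%:E)); last first.
  apply/funext => x /=; rewrite -partZE /fubini_G/=.
  rewrite (@integral_Q x0 (fun h => (expR (H h x - HQ h x0))%:E))//.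
    by apply: eq_integral => h _; rewrite -EFinM -expRD subrK.
  apply/measurable_EFinP; apply: measurableT_comp => //.
  by apply: measurable_funB; [exact: measurable_H_l|exact: measurable_canonH_l].
apply: measurable_fun_fubini_tonelli_G => //.
apply/measurable_EFinP; apply: measurableT_comp => //; apply: measurable_funB => //.
exact: (measurableT_comp (measurable_canonH_l x0) measurable_fst).
Qed.

Lemma measurable_canonH :
  measurable_fun setT (fun p : Hs * n.-tuple X => HQ p.1 p.2).
Proof.
apply: measurable_funB => //; apply: (measurableT_comp (@measurable_ln R)).
exact: (measurableT_comp measurable_partZ measurable_snd).
Qed.

Lemma measurable_canonH_r h : measurable_fun setT (HQ h).
Proof. exact: (measurableT_comp measurable_canonH (measurable_pair1 h)). Qed.

Let measurable_weighted (F : Hs * n.-tuple X -> \bar R) :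
  measurable_fun setT F ->
  measurable_fun setT (fun p => F p * (expR (HQ p.1 p.2 - HQ p.1 x0))%:E)%E.
Proof.
move=> mF; apply: emeasurable_funM => //; apply/measurable_EFinP.
apply: measurableT_comp => //; apply: measurable_funB; first exact: measurable_canonH.
exact: (measurableT_comp (measurable_canonH_l x0) measurable_fst).
Qed.

Section joint_integral.
Variable F : Hs * n.-tuple X -> \bar R.
Hypotheses (mF : measurable_fun setT F) (F0 : forall p, (0 <= F p)%E).

Let f (p : Hs * n.-tuple X) := (F p * (expR (HQ p.1 p.2 - HQ p.1 x0))%:E)%E.

Let f0 p : (0 <= f p)%E.
Proof. by rewrite mule_ge0// lee_fin expR_ge0. Qed.

Let integral_QE : (fun x => \int[Q x]_h F (h, x))%E = fubini_G (Q x0) f.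
Proof.
apply/funext => x; rewrite (@integral_Q_base x (fun h => F (h, x)))//.
exact: (measurableT_comp mF (measurable_pair2 x)).
Qed.

Lemma measurable_integral_Q :
  measurable_fun setT (fun x => \int[Q x]_h F (h, x))%E.
Proof.
rewrite integral_QE; apply: measurable_fun_fubini_tonelli_G => //.
exact: measurable_weighted.
Qed.

(** Once the dependence of [Q x] on [x] has moved into a weight against [Q x0], this is Tonelli for
    the product of [Q x0] and mu^n. *)
Lemma tuple_int_Q :
  (tuple_int mu (fun x => \int[Q x]_h F (h, x)) =
   \int[Q x0]_h tuple_int mu (fun x => F (h, x) * (expR (HQ h x - HQ h x0))%:E))%E.
Proof.
have mf := measurable_weighted mF.
rewrite tuple_intE//; last 2 first.
- exact: measurable_integral_Q.
- by move=> x; exact: integral_ge0.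
rewrite integral_QE -[LHS](@fubini_tonelli _ _ _ _ _ (Q x0) (tuple_probability mu n) f)//.
apply: eq_integral => h _; rewrite tuple_intE//.
- exact: (measurableT_comp mf (measurable_pair1 h)).
- by move=> x; exact: (f0 (h, x)).
Qed.

End joint_integral.

Variable c : R.
Hypothesis Hc : forall h, bounded_diff (H h) c.

(** One [c] comes from [H]. The other comes from [ln Z]: replacing a coordinate multiplies
    [expR (H h' x)] by at most [expR c] for every [h'], and this survives integration over [h']. *)
Lemma bounded_diff_canonH h : bounded_diff (HQ h) (2 * c).
Proof.
move=> k y y' x; rewrite /canonH.
have : partZ pi H (replace_at x k y') <= expR c * partZ pi H (replace_at x k y).
  rewrite -lee_fin EFinM -!partZE -ge0_integralZl//; last first.
    by apply/measurable_EFinP; apply: measurableT_comp => //; exact: measurable_H_l.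
  apply: ge0_le_integral => //.
  - by apply/measurable_EFinP; apply: measurableT_comp => //; exact: measurable_H_l.
  - apply: emeasurable_funM => //.
    by apply/measurable_EFinP; apply: measurableT_comp => //; exact: measurable_H_l.
  - move=> h' _; rewrite -EFinM lee_fin -expRD ler_expR.
    by have := Hc h' k y' y x; lra.
have := partZ_gt0 (replace_at x k y'); have := partZ_gt0 (replace_at x k y).
move: (partZ _ _ _) (partZ _ _ _) => Z Z' Z0 Z'0.
rewrite -ler_ln ?posrE ?mulr_gt0 ?expR_gt0// lnM ?posrE ?expR_gt0// expRK.
by have := Hc h k y y' x; lra.
Qed.

Lemma canonH_bounded h : exists M, forall x, `|HQ h x| <= M.
Proof. by eexists => x; exact: bounded_diff_norm_le x0 (bounded_diff_canonH h) x. Qed.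

End gibbs.

(** * The generalization gap: measurability, bounds and mean *)

Section gen_gap.
Context (R : realType) d (X : measurableType d) (mu : probability X R) (n : nat).
Context d' (Hs : measurableType d') (ev : Hs -> X -> R) (b : R).
Hypothesis n0 : (0 < n)%N.
Hypothesis mev : measurable_fun [set: Hs * X] (fun p : Hs * X => ev p.1 p.2).
Hypothesis evb : forall h y, 0 <= ev h y <= b.

Local Notation gap := (@gen_gap _ X R mu Hs ev n).
Local Notation P := (tuple_probability mu n).

Let nR_gt0 : 0 < n%:R :> R. Proof. by rewrite ltr0n. Qed.

Let ev_norm h y : `|ev h y| <= b.
Proof. by have /andP[e0 eb] := evb h y; rewrite ger0_norm. Qed.

Let mev_r h : measurable_fun setT (ev h).
Proof. exact: (measurableT_comp mev (measurable_pair1 h)). Qed.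

Let mean h := fine (\int[mu]_y (ev h y)%:E)%E.

Let meanE h : (\int[mu]_y (ev h y)%:E = (mean h)%:E)%E.
Proof.
rewrite fineK//; apply: integrable_fin_num => //.
exact: (@bounded_integrable _ _ _ mu _ b (mev_r h) (ev_norm h)).
Qed.

Let mean_bound h : 0 <= mean h <= b.
Proof.
apply/andP; split.
  by rewrite -lee_fin -meanE; apply: integral_ge0 => y _; rewrite lee_fin; have /andP[] := evb h y.
rewrite -lee_fin -meanE -(integral_prob_cst mu b); apply: ge0_le_integral => //.
- by move=> y _; rewrite lee_fin; have /andP[] := evb h y.
- exact/measurable_EFinP.
- by move=> y _; rewrite lee_fin; have /andP[] := evb h y.
Qed.

Lemma measurable_gen_gap :
  measurable_fun setT (fun p : Hs * n.-tuple X => gap p.1 p.2).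
Proof.
apply: measurable_funB.
  apply: (@measurableT_comp _ _ _ _ _ _ mean _ fst) => //.
  apply/measurable_EFinP.
  rewrite [X in measurable_fun _ X](_ : _ =
      fubini_F mu (fun p : Hs * X => (ev p.1 p.2)%:E)); last first.
    by apply/funext => h /=; rewrite -meanE.
  apply: measurable_fun_fubini_tonelli_F; first exact/measurable_EFinP.
  by move=> p; rewrite lee_fin; have /andP[] := evb p.1 p.2.
apply: measurable_funM => //; apply: measurable_sum => i.
have mp : measurable_fun setT (fun p : Hs * n.-tuple X => (p.1, tnth p.2 i)).
  apply: measurable_fun_pair => //.
  exact: (measurableT_comp (@measurable_tnth _ X n i) measurable_snd).
exact: (measurableT_comp mev mp).
Qed.

Lemma measurable_gen_gap_r h : measurable_fun setT (gap h).
Proof. exact: (measurableT_comp measurable_gen_gap (measurable_pair1 h)). Qed.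

(** Both the mean and the empirical average lie in [[0, b]]. *)
Lemma gen_gap_norm_le h x : `|gap h x| <= b.
Proof.
have S0 : 0 <= n%:R^-1 * \sum_(i < n) ev h (tnth x i).
  apply: mulr_ge0; first by rewrite invr_ge0 ltW.
  by apply: sumr_ge0 => i _; have /andP[] := evb h (tnth x i).
have Sb : n%:R^-1 * \sum_(i < n) ev h (tnth x i) <= b.
  rewrite mulrC ler_pdivrMr// mulr_natr -[X in _ *+ X](card_ord n) -sumr_const.
  by apply: ler_sum => i _; have /andP[] := evb h (tnth x i).
have /andP[m0 mb] := mean_bound h.
by rewrite /gen_gap -/(mean h) ler_norml; lra.
Qed.

(** Each coordinate has law [mu], so every term of the empirical average has integral [mean h]. *)
Lemma integral_gen_gap h : (\int[P]_x (gap h x)%:E = 0)%E.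
Proof.
have iev i : P.-integrable setT (fun x : n.-tuple X => (ev h (tnth x i))%:E).
  apply: (@bounded_integrable _ _ _ P (fun x => ev h (tnth x i)) b) => //.
  exact: (measurableT_comp (mev_r h) (@measurable_tnth _ X n i)).
have E i : (\int[P]_x (ev h (tnth x i))%:E = (mean h)%:E)%E.
  rewrite -tuple_intE//; first by rewrite (tuple_int_tnth mu i (EFin \o ev h)) -meanE.
    exact: measurable_int (iev i).
  by move=> x; rewrite lee_fin; have /andP[] := evb h (tnth x i).
have -> : (fun x => (gap h x)%:E) =
    (fun x => (mean h)%:E + (- n%:R^-1)%:E * \sum_(i < n) (ev h (tnth x i))%:E)%E.
  by apply/funext => x; rewrite sumEFin -EFinM -EFinD mulNr.
have isum : P.-integrable setT (fun x => \sum_(i < n) (ev h (tnth x i))%:E)%E.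
  exact: integrable_sum.
rewrite integralD//; last 2 first.
- exact: (@bounded_integrable _ _ _ P (fun=> mean h) `|mean h|).
- exact: integrableZl.
rewrite integral_prob_cst integralZl// integral_sum//.
under eq_bigr do rewrite E.
rewrite sumEFin sumr_const card_ord -EFinM -EFinD -mulr_natr.
by congr EFin; field; rewrite gt_eqF.
Qed.

Lemma bounded_diff_gen_gap lam h : 0 < lam ->
  bounded_diff (fun x => lam * gap h x) (lam * b / n%:R).
Proof.
move=> lam0 k y y' x.
have sumE z : \sum_(i < n) ev h (tnth (replace_at x k z) i) =
    ev h z + \sum_(i < n | i != k) ev h (tnth x i).
  rewrite (bigD1 k)//= tnth_mktuple eqxx; congr (_ + _).
  by apply: eq_bigr => i /negbTE ik; rewrite tnth_mktuple ik.
rewrite /gen_gap !sumE.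
set S := \sum_(i < n | _) _; set m := fine _.
(* The mean and the other summands cancel; the empirical average enters negatively, so [y] and [y']
   trade places. *)
have -> : lam * (m - n%:R^-1 * (ev h y + S)) - lam * (m - n%:R^-1 * (ev h y' + S)) =
   lam * (ev h y' - ev h y) / n%:R by field; rewrite gt_eqF.
rewrite ler_pM2r ?invr_gt0// ler_pM2l//.
by have /andP[? ?] := evb h y; have /andP[? ?] := evb h y'; lra.
Qed.

End gen_gap.

(** * Exponential moments and tail of the gap under the joint law *)

Lemma fine_le_EFin (R : realType) (x : \bar R) (r : R) :
  0 <= r -> (x <= r%:E)%E -> fine x <= r.
Proof. by case: x. Qed.

Section generalization.
Context (R : realType) d (X : measurableType d) (mu : probability X R) (n : nat).
Context d' (Hs : measurableType d') (ev : Hs -> X -> R).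
Context (pi : {measure set Hs -> \bar R}).
Variables (H : Hs -> n.-tuple X -> R) (Q : n.-tuple X -> probability Hs R) (b c : R).
Hypothesis n0 : (0 < n)%N.
Hypothesis mev : measurable_fun [set: Hs * X] (fun p : Hs * X => ev p.1 p.2).
Hypothesis mH :
  measurable_fun [set: Hs * n.-tuple X] (fun p : Hs * n.-tuple X => H p.1 p.2).
Hypothesis Z_fin : forall x : n.-tuple X, (0 < \int[pi]_h (expR (H h x))%:E < +oo)%E.
Hypothesis QE : forall (x : n.-tuple X) (A : set Hs), measurable A ->
  Q x A = (\int[pi]_(h in A) (expR (H h x) / partZ pi H x)%:E)%E.
Hypothesis Hc : forall h, bounded_diff (H h) c.
Hypothesis evb : forall h y, 0 <= ev h y <= b.

Local Notation HQ := (canonH pi H).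
Local Notation gap := (@gen_gap _ X R mu Hs ev n).
Local Notation P := (tuple_probability mu n).
Local Notation psi lam := (psiF mu pi H (fun h x => lam * gap h x)).

Variable x0 : n.-tuple X.

Let mHQ h : measurable_fun setT (HQ h).
Proof. exact: measurable_canonH_r mH Z_fin QE x0 h. Qed.

Let mgap h : measurable_fun setT (gap h).
Proof. exact: measurable_gen_gap_r mev evb h. Qed.

Let iHQ h : P.-integrable setT (EFin \o HQ h).
Proof.
have [M HM] := canonH_bounded mH Z_fin x0 Hc h.
exact: (@bounded_integrable _ _ _ P _ M (mHQ h) HM).
Qed.

Let igap h : P.-integrable setT (EFin \o gap h).
Proof.
apply: (@bounded_integrable _ _ _ P _ b (mgap h)) => x.
exact: gen_gap_norm_le.
Qed.

Let tuple_int_HQ h : (tuple_int mu (EFin \o HQ h) = \int[P]_x (HQ h x)%:E)%E.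
Proof.
have [M HM] := canonH_bounded mH Z_fin x0 Hc h.
exact: tuple_int_boundedE (mHQ h) HM.
Qed.

Let mexp_joint lam : measurable_fun setT
  (fun p : Hs * n.-tuple X => (expR (lam * gap p.1 p.2))%:E).
Proof.
apply/measurable_EFinP; apply: measurableT_comp => //; apply: measurable_funM => //.
exact: measurable_gen_gap.
Qed.

Lemma psiF_gen_gap_le lam h : 0 < lam ->
  psi lam h <= n%:R / 8 * (lam * b / n%:R + 2 * c) ^+ 2.
Proof.
move=> lam0; pose G x := lam * gap h x + HQ h x.
have mG : measurable_fun setT G by apply: measurable_funD => //; exact: measurable_funM.
have GD : bounded_diff G (lam * b / n%:R + 2 * c).
  move=> k y y' x.
  have D1 := bounded_diff_gen_gap mu n0 evb h lam0 k y y' x.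
  have D2 := bounded_diff_canonH mH Z_fin Hc h k y y' x.
  by rewrite /G opprD addrACA; exact: lerD D1 D2.
(* As the gap has mean 0, the centering by the mean of [HQ] in psi is the centering of [G] that
   McDiarmid's inequality requires. *)
have EG : tuple_int mu (EFin \o G) = tuple_int mu (EFin \o HQ h).
  rewrite (tuple_int_boundedE mu mG (bounded_diff_norm_le x0 GD)) tuple_int_HQ.
  under eq_integral do rewrite /G EFinD EFinM.
  rewrite (integralD measurableT (integrableZl measurableT lam (igap h)) (iHQ h)).
  by rewrite (integralZl measurableT (igap h)) (integral_gen_gap mu n0 mev evb) mule0 add0e.
have K0 : 0 <= n%:R / 8 * (lam * b / n%:R + 2 * c) ^+ 2.
  by rewrite mulr_ge0// ?sqr_ge0// divr_ge0.
(* Nonnegative bounds are needed because [ln] and [fine] may return the default 0. *)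
apply: ln_le_expR => //; apply: fine_le_EFin; first exact: expR_ge0.
have := mcdiarmid_mgf mu mG GD; rewrite EG /G.
by rewrite [X in (_ <= (expR X)%:E)%E -> _](_ : _ =
  n%:R / 8 * (lam * b / n%:R + 2 * c) ^+ 2)//; ring.
Qed.

(** Stated for any upper bound [S] of psi, so that it serves both with the supremum in (i) and with
    the explicit bound in (ii). *)
Lemma joint_mgf_le lam S : (forall h, psi lam h <= S) ->
  (tuple_int mu (fun x => \int[Q x]_h (expR (lam * gap h x))%:E) <=
   (expR S)%:E)%E.
Proof.
move=> psiS.
pose W h x := HQ h x - HQ h x0.
have mW h : measurable_fun setT (fun x => (expR (W h x))%:E).
  by apply/measurable_EFinP; apply: measurableT_comp => //; exact: measurable_funB.
have mWj : measurable_fun setT (fun p : Hs * n.-tuple X => (expR (W p.1 p.2))%:E).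
  apply/measurable_EFinP; apply: measurableT_comp => //; apply: measurable_funB.
    exact: measurable_canonH mH Z_fin QE x0.
  exact: (measurableT_comp (measurable_canonH_l pi mH x0) measurable_fst).
rewrite (tuple_int_Q mu mH Z_fin QE x0 (mexp_joint lam)); last first.
  by move=> p; rewrite lee_fin expR_ge0.
have mTW : measurable_fun setT (fun h => tuple_int mu (fun x => (expR (W h x))%:E)).
  exact: (measurable_tuple_int mu mWj (fun p => _)).
(* The factor next to [expR S] is the total mass of the joint law, rewritten by [tuple_int_Q] with
   integrand 1. *)
have -> : (expR S)%:E =
    (\int[Q x0]_h ((expR S)%:E * tuple_int mu (fun x => (expR (W h x))%:E)))%E.
  rewrite ge0_integralZl//; last by move=> h _; rewrite tuple_intE//; exact: integral_ge0.
  rewrite -[X in (_ = _ * X)%E](_ : (1 = _)%E) ?mule1//.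
  transitivity (tuple_int mu (fun x => \int[Q x]_h 1)%E).
    under eq_fun do rewrite (integral_prob_cst (Q _) 1).
    by rewrite tuple_int_cst.
  rewrite (@tuple_int_Q _ _ _ mu _ _ _ _ _ _ mH Z_fin QE x0 (fun=> 1%E))//.
  by apply: eq_integral => h _; under eq_fun do rewrite mul1e.
have mE h : measurable_fun setT (fun x => (expR (lam * gap h x) * expR (W h x))%:E).
  apply/measurable_EFinP; apply: measurable_funM; last by apply/measurable_EFinP; exact: mW.
  by apply: measurableT_comp => //; exact: measurable_funM.
apply: ge0_le_integral => //.
- move=> h _; rewrite tuple_intE//; first exact: integral_ge0.
  exact: mE.
- apply: (@measurable_tuple_int _ X _ mu _ Hs n
    (fun p => (expR (lam * gap p.1 p.2))%:E * (expR (W p.1 p.2))%:E)%E).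
    by apply: emeasurable_funM => //; exact: mexp_joint.
  by move=> p; rewrite mule_ge0// lee_fin expR_ge0.
- exact: emeasurable_funM.
move=> h _.
pose m := fine (tuple_int mu (EFin \o HQ h)).
pose E := tuple_int mu (fun x => (expR (lam * gap h x + HQ h x - m))%:E).
have mEm : measurable_fun setT (fun x => (expR (lam * gap h x + HQ h x - m))%:E).
  apply/measurable_EFinP; apply: measurableT_comp => //; apply: measurable_funB => //.
  by apply: measurable_funD => //; exact: measurable_funM.
(* [E] stands for [expR (psi lam h)]. Its finiteness has to be shown, since psi is defined through
   [fine]. *)
have EleS : (E <= (expR S)%:E)%E.
  have [M HM] := canonH_bounded mH Z_fin x0 Hc h.
  have Efin : E \is a fin_num.
    rewrite /E tuple_intE//; apply: (@integrable_fin_num _ _ _ P) => //.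
    apply: (@bounded_integrable _ _ _ P (fun x => expR (lam * gap h x + HQ h x - m))
      (expR (`|lam| * b + M - m))); first exact/measurable_EFinP.
    move=> x; rewrite ger0_norm ?expR_ge0// ler_expR lerB// lerD//.
      rewrite (le_trans (ler_norm _))// normrM ler_wpM2l//.
      exact: gen_gap_norm_le.
    exact: le_trans (ler_norm _) (HM x).
  rewrite -(fineK Efin) lee_fin (le_trans (le_expR_ln _))// ler_expR.
  exact: psiS.
have -> : tuple_int mu (fun x => (expR (lam * gap h x))%:E * (expR (W h x))%:E)%E =
    (E * (expR (m - HQ h x0))%:E)%E.
  rewrite /E !tuple_intE//; last exact: mE.
  rewrite -(ge0_integralZr P measurableT mEm (fun x _ => _) (_ : (0 <= (expR (m - HQ h x0))%:E)%E))//.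
  apply: eq_integral => x _; rewrite -!EFinM -!expRD.
  by congr (expR _)%:E; rewrite /W; ring.
apply: (@le_trans _ _ ((expR S)%:E * (expR (m - HQ h x0))%:E)%E).
  by rewrite lee_wpmul2r// lee_fin expR_ge0.
(* What remains is Jensen: [expR m] is at most the expectation of [expR (HQ h X)], both divided by
   [expR (HQ h x0)]. *)
rewrite lee_wpmul2l ?lee_fin ?expR_ge0// tuple_intE//.
have [M HM] := canonH_bounded mH Z_fin x0 Hc h.
rewrite /W expRD EFinM; under eq_integral do rewrite expRD EFinM.
rewrite ge0_integralZr//; last by apply/measurable_EFinP; exact: measurableT_comp.
rewrite lee_wpmul2r ?lee_fin ?expR_ge0// /m tuple_int_HQ.
exact: jensen_expR HM.
Qed.

Let measurable_Q_integral (F : Hs * n.-tuple X -> \bar R) :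
  measurable_fun setT F -> (forall p, 0 <= F p)%E ->
  measurable_fun setT (fun x => \int[Q x]_h F (h, x))%E.
Proof.
exact: measurable_integral_Q mH Z_fin QE x0 F.
Qed.

(** The gap is at least [- b]. This keeps the joint moment generating function positive, so that its
    logarithm is a true one. *)
Lemma joint_mgf_ge lam : 0 <= lam ->
  ((expR (- (lam * b)))%:E <=
   tuple_int mu (fun x => \int[Q x]_h (expR (lam * gap h x))%:E))%E.
Proof.
move=> lam0; rewrite tuple_intE//; last 2 first.
- exact: (measurable_Q_integral (mexp_joint lam) (fun p => _)).
- by move=> x; apply: integral_ge0 => h _; rewrite lee_fin expR_ge0.
rewrite -(integral_prob_cst P); apply: ge0_le_integral => //.
- exact: (measurable_Q_integral (mexp_joint lam) (fun p => _)).
move=> x _; rewrite -(integral_prob_cst (Q x)); apply: ge0_le_integral => //.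
- exact: (measurableT_comp (mexp_joint lam) (measurable_pair2 x)).
- move=> h _; rewrite lee_fin ler_expR -mulrN ler_wpM2l//.
  by have := gen_gap_norm_le mu n0 mev evb h x; rewrite ler_norml => /andP[].
Qed.

(* Markov's inequality, from [1 <= \1_(gap <= s) + exp (lam * (gap - s))]. *)
Lemma joint_tail_le lam s (K : R) : 0 <= lam ->
  (tuple_int mu (fun x => \int[Q x]_h (expR (lam * gap h x))%:E) <= K%:E)%E ->
  ((1 - expR (- (lam * s)) * K)%:E <=
   tuple_int mu (fun x => Q x [set h | (gap h x <= s)%R]))%E.
Proof.
move=> lam0 mgfK.
have mle e (T : measurableType e) (f : T -> R) : measurable_fun setT f ->
    measurable [set t | f t <= s].
  move=> /(_ measurableT `]-oo, s]%classic (measurable_itv _)).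
  by rewrite setTI set_itvE.
have mg : measurable_fun setT (fun p : Hs * n.-tuple X => gap p.1 p.2).
  exact: measurable_gen_gap mev evb.
pose A := [set p : Hs * n.-tuple X | gap p.1 p.2 <= s].
pose IA (p : Hs * n.-tuple X) := (\1_A p)%:E : \bar R.
have mIA : measurable_fun setT IA.
  by apply/measurable_EFinP; apply: measurable_indic; exact: mle.
have IA0 p : (0 <= IA p)%E by rewrite lee_fin.
have mIAx x : measurable_fun setT (fun h => IA (h, x)).
  exact: (measurableT_comp mIA (measurable_pair2 x)).
have mex x : measurable_fun setT (fun h => (expR (lam * gap h x))%:E).
  exact: (measurableT_comp (mexp_joint lam) (measurable_pair2 x)).
(* As the integral of a jointly measurable indicator, the conditional probability is measurable in
   [x]. *)
have -> : (fun x => Q x [set h | gap h x <= s]) = (fun x => \int[Q x]_h IA (h, x))%E.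
  apply/funext => x; have mAx : measurable [set h | gap h x <= s].
    exact: (mle _ _ _ (measurableT_comp mg (measurable_pair2 x))).
  rewrite -[in LHS](setIT [set h | gap h x <= s]) -[LHS](integral_indic (Q x) measurableT mAx).
  by [].
have mQA := measurable_Q_integral mIA IA0.
have mQe : measurable_fun setT (fun x => \int[Q x]_h (expR (lam * gap h x))%:E)%E.
  exact: (measurable_Q_integral (mexp_joint lam) (fun p => _)).
set U := tuple_int mu _; set V := tuple_int mu _ in mgfK.
have step : (1 <= U + (expR (- (lam * s)))%:E * V)%E.
  rewrite /U /V !tuple_intE//; last 2 first.
  - by move=> x; exact: integral_ge0.
  - by move=> x; exact: integral_ge0.
  rewrite -ge0_integralZl//; last by move=> x _; exact: integral_ge0.
  rewrite -ge0_integralD//; last 3 first.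
  - by move=> x _; exact: integral_ge0.
  - by move=> x _; rewrite mule_ge0//; exact: integral_ge0.
  - exact: emeasurable_funM.
  rewrite -[leLHS](integral_prob_cst P 1); apply: ge0_le_integral => //.
  - by apply: emeasurable_funD => //; exact: emeasurable_funM.
  move=> x _; rewrite -ge0_integralZl// -ge0_integralD//; last first.
    exact: emeasurable_funM.
  rewrite -[leLHS](integral_prob_cst (Q x) 1); apply: ge0_le_integral => //.
  - by apply: emeasurable_funD => //; exact: emeasurable_funM.
  move=> h _; rewrite /IA -EFinM -EFinD lee_fin indicE -expRD.
  have [gs|sg] := leP (gap h x) s.
    by rewrite mem_set// lerDl expR_ge0.
  rewrite memNset/= ?add0r; last by rewrite /A/= leNgt sg.
  by rewrite addrC -mulrN -mulrDr -expR0 ler_expR mulr_ge0// subr_ge0 ltW.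
have : (1 <= U + (expR (- (lam * s)) * K)%:E)%E.
  by rewrite (le_trans step)// leeD2l// EFinM lee_wpmul2l// lee_fin expR_ge0.
by rewrite EFinB leeBlDr.
Qed.

End generalization.

(** * Choice of [lam] and the two bounds *)

Lemma tuple_int_ge0 d (X : measurableType d) (R : realType)
    (mu : {measure set X -> \bar R}) n (f : n.-tuple X -> \bar R) :
  (forall x, 0 <= f x)%E -> (0 <= tuple_int mu f)%E.
Proof.
by elim: n f => [|n IH] f f0 /=; [exact: f0|apply: integral_ge0 => x _; exact: IH].
Qed.

(* The exponent that Markov's inequality leaves at the minimizing [lam] is
   [- 2 * n * r * (c + r)]. *)
Lemma chernoff_exponent_le (R : realType) (n : nat) (b c r : R) :
  (0 < n)%N -> 0 < b -> 0 <= c -> 0 <= r ->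
  let lam := 4 * n%:R * (c / 2 + r) / b in
  - (lam * (b * (c + r))) + n%:R / 8 * (lam * b / n%:R + 2 * c) ^+ 2 <=
  - (2 * n%:R * r ^+ 2).
Proof.
move=> n0 b0 c0 r0 /=; have N0 : 0 < n%:R :> R by rewrite ltr0n.
move: (n%:R : R) N0 => N N0.
have -> : - (4 * N * (c / 2 + r) / b * (b * (c + r))) +
    N / 8 * (4 * N * (c / 2 + r) / b * b / N + 2 * c) ^+ 2 =
    - (2 * N * r ^+ 2) - 2 * N * (c * r).
  by field; rewrite !gt_eqF.
(* The cross term [2 * N * (c * r)] is given away. *)
by rewrite gerBl mulr_ge0 ?mulr_ge0// ltW.
Qed.

Theorem theorem4 (R : realType) (d : measure_display) (X : measurableType d)
  (mu : probability X R) (n : nat)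
  (d' : measure_display) (Hs : measurableType d') (ev : Hs -> X -> R)
  (pi : {measure set Hs -> \bar R})
  (H : Hs -> n.-tuple X -> R) (Q : n.-tuple X -> probability Hs R) (b c : R) :
  (0 < n)%N ->
  measurable_fun [set: Hs * X] (fun p : Hs * X => ev p.1 p.2) ->
  measurable_fun [set: Hs * n.-tuple X] (fun p : Hs * n.-tuple X => H p.1 p.2) ->
  (forall x : n.-tuple X, (0 < \int[pi]_h (expR (H h x))%:E < +oo)%E) ->
  (forall (x : n.-tuple X) (A : set Hs), measurable A ->
     Q x A = (\int[pi]_(h in A) (expR (H h x) / partZ pi H x)%:E)%E) ->
  (forall (k : 'I_n) (h : Hs) (y y' : X) (x : n.-tuple X),
     H h (replace_at x k y) - H h (replace_at x k y') <= c) ->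
  (forall (h : Hs) (y : X), 0 <= ev h y <= b) ->
  (forall lam : R, 0 < lam ->
     ((ln (fine (tuple_int mu (fun x : n.-tuple X =>
              (\int[Q x]_h (expR (lam * gen_gap mu ev h x))%:E)%E))))%:E
        <= ereal_sup [set (psiF mu pi H (fun h x => lam * gen_gap mu ev h x) h)%:E | h in [set: Hs]])%E
     /\
     (ereal_sup [set (psiF mu pi H (fun h x => lam * gen_gap mu ev h x) h)%:E | h in [set: Hs]]
        <= (n%:R / 8 * (lam * b / n%:R + 2 * c) ^+ 2)%:E)%E)
  /\
  (forall dlt : R, 0 < dlt ->
     ((1 - dlt)%R%:E <=
       tuple_int mu (fun x : n.-tuple X =>
         Q x ([set h | (gen_gap mu ev h x <= b * (c + Num.sqrt (ln (dlt^-1) / (2 * n%:R))))%R])))%E).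
Proof.
move=> n0 mev mH Zf QE Hc evb.
have [y0] := probability_inhabited mu; pose x0 := nseq_tuple n y0.
have [h0] := probability_inhabited (Q x0).
have Hc' h : bounded_diff (H h) c by move=> k y y' x; exact: Hc.
(* With [y = y'] the difference is 0; [0 < n] provides a coordinate. *)
have c0 : 0 <= c by have := Hc (Ordinal n0) h0 y0 y0 x0; rewrite subrr.
have b0 : 0 <= b by have /andP[e0] := evb h0 y0; exact: le_trans.
pose K lam := n%:R / 8 * (lam * b / n%:R + 2 * c) ^+ 2.
have psiK lam h : 0 < lam -> psiF mu pi H (fun h x => lam * gen_gap mu ev h x) h <= K lam.
  by move=> lam0; exact: (psiF_gen_gap_le mu n0 mev mH Zf QE Hc' evb x0).
have mgf lam S := @joint_mgf_le _ _ _ mu _ _ _ _ _ _ _ b c n0 mev mH Zf QE Hc' evb x0 lam S.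
split=> [lam lam0|dlt dlt0].
  set S := ereal_sup _.
  have SK : (S <= (K lam)%:E)%E.
    by apply: ge_ereal_sup => _ [h _ <-]; rewrite lee_fin psiK.
  split=> //.
  have psiS h : ((psiF mu pi H (fun h x => lam * gen_gap mu ev h x) h)%:E <= S)%E.
    by apply: ereal_sup_ubound; exists h.
  (* The supremum is real: [SK] excludes [+oo], and the value at [h0] excludes [-oo]. *)
  move: S SK psiS => [s| |] SK psiS; [|by []|by have := psiS h0].
  have Js : forall h, psiF mu pi H (fun h x => lam * gen_gap mu ev h x) h <= s.
    by move=> h; rewrite -lee_fin.
  have := mgf lam s Js.
  have := @joint_mgf_ge _ _ _ mu _ _ _ _ _ _ _ b n0 mev mH Zf QE evb x0 lam (ltW lam0).
  case: (tuple_int _ _) => [j| |]//; rewrite !lee_fin /= => j0 js.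
  by rewrite -ler_expR lnK// posrE (lt_le_trans (expR_gt0 _) j0).
(* For [dlt >= 1] the claimed probability is at most 0; below 1 the logarithm under the root is
   positive. *)
have [dlt1|dlt1] := leP 1 dlt.
  apply: (@le_trans _ _ 0%E); first by rewrite lee_fin subr_le0.
  by apply: tuple_int_ge0 => x; exact: measure_ge0.
(* The optimal [lam] divides by [b]. If [b = 0], the gap is at most 0 everywhere and the event is
   certain. *)
have [b_eq0|b_neq0] := eqVneq b 0.
  rewrite [X in (_ <= tuple_int _ X)%E](_ : _ = fun=> 1%E); last first.
    apply/funext => x; rewrite (_ : [set h | _] = setT) ?probability_setT//.
    apply/seteqP; split=> // h _ /=; rewrite b_eq0 mul0r.
    have := gen_gap_norm_le mu n0 mev evb h x.
    by rewrite b_eq0 => /(le_trans (ler_norm _)).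
  by rewrite tuple_int_cst lee_fin gerBl ltW.
have b_gt0 : 0 < b by rewrite lt_neqAle eq_sym b_neq0.
have N0 : 0 < n%:R :> R by rewrite ltr0n.
set r := Num.sqrt _.
have L0 : 0 < ln dlt^-1 by rewrite ln_gt0// invf_gt1.
have r2 : 2 * n%:R * r ^+ 2 = ln dlt^-1.
  rewrite sqr_sqrtr ?divr_ge0 ?(ltW L0)// ?mulr_ge0// ?(ltW N0)//.
  by rewrite mulrC divfK// gt_eqF// mulr_gt0.
have r_gt0 : 0 < r by rewrite sqrtr_gt0 divr_gt0// mulr_gt0.
(* Minimizer of [- lam * b * (c + r) + K lam]: the derivative vanishes when
   [lam * b / n = 2 * c + 4 * r]. *)
pose lam := 4 * n%:R * (c / 2 + r) / b.
have lam0 : 0 < lam.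
  by rewrite divr_gt0// mulr_gt0 ?mulr_gt0// ltr_wpDl// divr_ge0.
have := @joint_tail_le _ _ _ mu _ _ _ _ _ _ _ b mev mH Zf QE evb x0 lam (b * (c + r))
  (expR (K lam)) (ltW lam0) (mgf lam (K lam) (fun h => psiK lam h lam0)).
apply: le_trans; rewrite lee_fin lerB// -expRD.
rewrite -[leRHS]lnK ?posrE// ler_expR.
apply: (le_trans (chernoff_exponent_le n0 b_gt0 c0 (ltW r_gt0))).
by rewrite r2 lnV ?posrE// opprK.
Qed.
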